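(* Let $\ell,n\ge1$, let $t_1,\dots,t_\ell,x_1,\dots,x_n\in(0,1)$, and consider last passage percolation on a random matrix with independent geometric entries $w_{ij}$ ($1\le i\le\ell$, $1\le j\le n$), $P(w_{ij}=k)=(1-t_ix_j)(t_ix_j)^k$ for $k\in\mathbb{Z}_{\ge0}$. Let $\mathbf{G}(n)=(G(\ell,n),G(\ell-1,n),\dots,G(1,n))$ be the vector of last passage times. Then for every partition $\lambda=(\lambda_1\ge\dots\ge\lambda_\ell\ge0)$, $$P(\mathbf{G}(n)=\lambda)=\prod_{i=1}^{\ell}\prod_{j=1}^{n}(1-t_ix_j)\ \mathbf{t}^{\lambda}\ g_\lambda(\mathbf{x};\mathbf{t}^{-1}).$$
   Context: Matrices are indexed following the natural indexing on $\mathbb{Z}^2$, so that the bottom-left corner is the $(1,1)$ entry. The last passage time is $G(m,n)=\max_\Pi\sum_{(i,j)\in\Pi}w_{ij}$, the maximum over all lattice paths $\Pi$ from $(1,1)$ to $(m,n)$ with unit steps to the right or up, i.e. each step goes from $(i,j)$ to $(i,j+1)$ or to $(i+1,j)$. Here $\mathbf{x}=(x_1,\dots,x_n)$, $\mathbf{t}=(t_1,\dots,t_\ell)$, $\mathbf{t}^\lambda=\prod_{i=1}^\ell t_i^{\lambda_i}$ and $\mathbf{t}^{-1}=(t_1^{-1},\dots,t_\ell^{-1})$. A reverse plane partition of shape $\lambda$ (English convention, row 1 at the top) is a filling of the boxes of $\lambda$ with positive integers that weakly increases along rows and down columns. Let $\mathrm{RPP}^n(\lambda)$ be the set of those with all entries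 at most $n$. For $T\in\mathrm{RPP}^n(\lambda)$, let $a_i$ be the number of columns of $T$ containing $i$, and let $b_r$ be the number of boxes in row $r$ whose entry equals the entry in the box directly below. The refined dual Grothendieck polynomial is $g_\lambda(\mathbf{x};\mathbf{u}):=\sum_{T\in\mathrm{RPP}^n(\lambda)}\prod_{r}u_r^{b_r}\prod_{i}x_i^{a_i}$ (only the variables $u_r$ with $r$ less than the number of nonzero parts of $\lambda$ occur).
   Formalization: The weight w_ij is given parameter t_{ℓ+1-i} x_j instead of t_i x_j, since with the printed order the identity fails for ℓ=2, n=1, λ=(1,0) whenever t_1≠t_2 (left side has t_2 x_1, right side t_1 x_1). *)

(* Defs.v *)
From HB Require Import structures.
From mathcomp Require Import all_boot all_order all_algebra.
From mathcomp Require Import all_classical all_reals all_analysis.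

Set Implicit Arguments.
Unset Strict Implicit.
Unset Printing Implicit Defensive.

Import Order.TTheory GRing.Theory Num.Theory.

(* Throughout, the ordinal i : 'I_k stands for the 1-based index i.+1. *)

Section LastPassage.
Variables (l n : nat).

Definition lattice_step (c c' : 'I_l * 'I_n) : bool :=
  ((c'.1 == c.1 :> nat) && (c'.2 == c.2.+1 :> nat)) ||
  ((c'.1 == c.1.+1 :> nat) && (c'.2 == c.2 :> nat)).

(* m and k are 1-based: s runs from (1,1) to (m,k). *)
Definition lattice_path (m k : nat) (s : seq ('I_l * 'I_n)) : bool :=
  if s is c :: s' then
    [&& c.1 == 0 :> nat, c.2 == 0 :> nat, path lattice_step c s',
        (last c s').1.+1 == m & (last c s').2.+1 == k]
  else false.

(* A path from (1,1) to (m,k) visits exactly m + k - 1 points, so ranging over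
   tuples of that length loses no path.  Meaningful for 1 <= m <= l and
   1 <= k <= n; otherwise there is no path and the value is 0. *)
Definition last_passage (w : 'I_l -> 'I_n -> nat) (m k : nat) : nat :=
  \max_(s : (m + k).-1.-tuple ('I_l * 'I_n) | lattice_path m k s)
    \sum_(c <- s) w c.1 c.2.

Definition last_passage_vector (w : 'I_l -> 'I_n -> nat) : l.-tuple nat :=
  [tuple last_passage w (l - i) n | i < l].

End LastPassage.

Section DualGrothendieck.
Variables (l : nat) (lam : l.-tuple nat) (n : nat).

Definition box : finType := {r : 'I_l & 'I_(tnth lam r)}.
Definition brow (b : box) : 'I_l := tag b.
Definition bcol (b : box) : nat := tagged b.

Definition filling : finType := {ffun box -> 'I_n}.

Definition is_rpp (T : filling) : bool :=
  [forall b : box, forall b' : box,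
    ((brow b == brow b') && (bcol b <= bcol b')%N ||
     (bcol b == bcol b') && (brow b <= brow b')%N) ==> (T b <= T b')%N].

Definition rpp_a (T : filling) (i : 'I_n) : nat :=
  #|[pred c : 'I_(nth 0%N lam 0) |
      [exists b : box, (bcol b == c) && (T b == i)]]|.

Definition rpp_b (T : filling) (r : 'I_l) : nat :=
  #|[pred b : box | (brow b == r) &&
      [exists b' : box, [&& brow b' == (brow b).+1 :> nat,
                            bcol b' == bcol b & T b' == T b]]]|.

(* The exponent of u_r vanishes unless r is less than the number of nonzero
   parts of lam, so the superfluous variables u_r do not occur. *)
Definition dual_grothendieck (R : comNzRingType)
    (x : 'I_n -> R) (u : 'I_l -> R) : R :=
  (\sum_(T : filling | is_rpp T)
     (\prod_(r < l) u r ^+ rpp_b T r) * (\prod_(i < n) x i ^+ rpp_a T i))%R.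

End DualGrothendieck.

Definition mutually_independent d (T : measurableType d) (R : realType)
    (P : probability T R) (I : finType) d' (T' : measurableType d')
    (X : I -> {RV P >-> T'}) : Prop :=
  forall (J : {set I}) (B : I -> set T'),
    (forall i, i \in J -> measurable (B i)) ->
    P (\bigcap_(i in [set` J]) (X i @^-1` B i))%classic =
    (\prod_(i in J) P (X i @^-1` B i)%classic)%E.

(* Main.v *)
(* A reverse plane partition T of shape lambda with entries at most n is the chain
   of the shapes filled by its entries at most j, for j = 0, ..., n.  Let W_T(r,j)
   count the columns in which the lowest occurrence of j is in row r.  The r-th
   parts of these shapes satisfy the recursion of last passage percolation,
     S(r,j) = max(S(r+1,j), S(r,j-1)) + W_T(r,j),
   because columns with entry at most j in row r either have such an entry in row
   r+1, or an entry less than j in row r, or are counted by W_T(r,j).  Hence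
   T |-> W_T is a bijection from reverse plane partitions to weight matrices with
   G(n) = lambda.  The sums of W_T over j and over r are lambda_r - b_r and a_j,
   so the probability of {w = W_T} is the term of T in the formula. *)
Require Import Defs.
From mathcomp Require Import all_boot all_order all_algebra.
From mathcomp Require Import all_classical all_reals all_analysis.
From mathcomp Require Import zify.

Set Implicit Arguments.
Unset Strict Implicit.
Unset Printing Implicit Defensive.

Import Order.TTheory GRing.Theory Num.Theory.

(** * Recursion for last passage times *)

Section LastPassageRecursion.
Variables (l n : nat).
Implicit Types (w : 'I_l -> 'I_n -> nat) (s : seq ('I_l * 'I_n)).

(** The recursion looks at the last step of a path. As [c] is 0-based, its predecessors end at the
    1-based points [(c.1, c.2.+1)] and [(c.1.+1, c.2)]. *)
Lemma lattice_path_rcons m k s c :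
  lattice_path m k (rcons s c) =
  [&& c.1.+1 == m, c.2.+1 == k &
      if s is [::] then (c.1 == 0 :> nat) && (c.2 == 0 :> nat)
      else lattice_path c.1 c.2.+1 s || lattice_path c.1.+1 c.2 s].
Proof.
case: s => [|c0 s] /=; first by do !case: (_ == _).
rewrite rcons_path last_rcons /lattice_step.
set a := path _ _ _; set u := last _ _.
by case: a => /=; lia.
Qed.

Lemma lattice_path_size m k s : lattice_path m k s -> size s = (m + k).-1.
Proof.
elim/last_ind: s m k => [|s c IH] m k //.
rewrite lattice_path_rcons size_rcons => /and3P[/eqP<- /eqP<-].
case: s IH => [|c0 s] IH; first by move=> /= /andP[/eqP-> /eqP->].
by move=> /orP[] /IH ->; lia.
Qed.

Lemma lattice_path_exists (i : 'I_l) (j : 'I_n) :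
  exists s, lattice_path i.+1 j.+1 s.
Proof.
case: i j => i il [j jn] /=.
elim: i il => [|i IH] il.
  elim: j jn => [|j IH] jn.
    by exists (rcons [::] (Ordinal il, Ordinal jn)); rewrite lattice_path_rcons !eqxx.
  have [s hs] := IH (ltnW jn); exists (rcons s (Ordinal il, Ordinal jn)).
  by rewrite lattice_path_rcons !eqxx /=; case: s hs => // c s ->; rewrite orbT.
have [s hs] := IH (ltnW il); exists (rcons s (Ordinal il, Ordinal jn)).
by rewrite lattice_path_rcons !eqxx /=; case: s hs => // c s ->.
Qed.

Lemma leq_last_passage w m k s :
  lattice_path m k s -> \sum_(c <- s) w c.1 c.2 <= last_passage w m k.
Proof.
move=> hs; have /eqP szs := lattice_path_size hs.
exact: (@leq_bigmax_cond _ _ (fun s : (m + k).-1.-tuple _ => \sum_(c <- s) w c.1 c.2)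
  (Tuple szs)).
Qed.

Lemma last_passage_leqP w m k v :
  reflect (forall s, lattice_path m k s -> \sum_(c <- s) w c.1 c.2 <= v)
          (last_passage w m k <= v).
Proof.
apply: (iffP idP) => [h s /leq_last_passage hs|h]; first exact: leq_trans (hs w) h.
by apply/bigmax_leqP => s; exact: h.
Qed.

Lemma last_passage_attained w m k :
  last_passage w m k = 0 \/
  exists2 s, lattice_path m k s & last_passage w m k = \sum_(c <- s) w c.1 c.2.
Proof.
pose A := [pred s : (m + k).-1.-tuple ('I_l * 'I_n) | lattice_path m k s].
have [A0|A_gt0] := posnP #|A|.
  by left; rewrite /last_passage big_pred0 // => s; exact: (card0_eq A0 s).
have [s hs es] := eq_bigmax_cond
  (fun s : (m + k).-1.-tuple ('I_l * 'I_n) => \sum_(c <- s) w c.1 c.2) A_gt0.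
by right; exists s.
Qed.

Lemma last_passage0n w k : last_passage w 0 k = 0.
Proof.
by apply/eqP; rewrite -leqn0; apply/last_passage_leqP => -[//|c s]; rewrite /= !andbF.
Qed.

Lemma last_passagen0 w m : last_passage w m 0 = 0.
Proof.
by apply/eqP; rewrite -leqn0; apply/last_passage_leqP => -[//|c s]; rewrite /= !andbF.
Qed.

Lemma last_passageSS w (i : 'I_l) (j : 'I_n) :
  last_passage w i.+1 j.+1 =
  maxn (last_passage w i j.+1) (last_passage w i.+1 j) + w i j.
Proof.
apply/eqP; rewrite eqn_leq; apply/andP; split.
  apply/last_passage_leqP => s; elim/last_ind: s => // s c _.
  rewrite lattice_path_rcons big_rcons /=.
  case: c => i' j' /= /and3P[/eqP[/val_inj->] /eqP[/val_inj->] hs].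
  rewrite leq_add2r; case: s hs => [|c s] hs; first by rewrite big_nil.
  rewrite leq_max.
  by case/orP: hs => /(leq_last_passage w) -> //; rewrite orbT.
have w_le s : lattice_path i j.+1 s || lattice_path i.+1 j s ->
    \sum_(c <- s) w c.1 c.2 + w i j <= last_passage w i.+1 j.+1.
  move=> hs; suff /(leq_last_passage w): lattice_path i.+1 j.+1 (rcons s (i, j)).
    by rewrite big_rcons.
  by rewrite lattice_path_rcons !eqxx /=; case: s hs.
(* Covers a predecessor outside the matrix, where the last passage time is the default 0. *)
have w_le0 : w i j <= last_passage w i.+1 j.+1.
  have [s hs] := lattice_path_exists i j.
  apply: leq_trans (leq_last_passage w hs).
  elim/last_ind: s hs => // s c _; rewrite lattice_path_rcons big_rcons /=.
  case: c => i' j' /= /and3P[/eqP[/val_inj->] /eqP[/val_inj->] _].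
  exact: leq_addl.
rewrite addn_maxl geq_max; apply/andP; split.
  have [->//|[s hs ->]] := last_passage_attained w i j.+1.
  by apply: w_le; rewrite hs.
have [->//|[s hs ->]] := last_passage_attained w i.+1 j.
by apply: w_le; rewrite hs orbT.
Qed.

Lemma last_passage_unique w (F : nat -> nat -> nat) :
  (forall k, F 0 k = 0) -> (forall m, F m 0 = 0) ->
  (forall (i : 'I_l) (j : 'I_n),
     F i.+1 j.+1 = maxn (F i j.+1) (F i.+1 j) + w i j) ->
  forall m k, m <= l -> k <= n -> last_passage w m k = F m k.
Proof.
move=> F0n Fn0 FSS; elim=> [|m IHm] k; first by rewrite last_passage0n F0n.
elim: k => [|k IHk] ml kn; first by rewrite last_passagen0 Fn0.
rewrite (last_passageSS w (Ordinal ml) (Ordinal kn)) /=.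
by rewrite IHm ?IHk // 1?ltnW // -(FSS (Ordinal ml) (Ordinal kn)).
Qed.

End LastPassageRecursion.

(** * Cardinalities of initial segments *)

Lemma eq_from_ltn a b : (forall c, (c < a) = (c < b)) -> a = b.
Proof.
by move=> h; case: (ltngtP a b) => // ab; [have := h a | have := h b];
  rewrite ltnn ab.
Qed.

Section DownClosed.
Variable N : nat.

Definition downclosed (p : pred nat) := forall a b, a <= b -> p b -> p a.

(** A down-closed set is an initial segment, so its size is the first element it misses. *)
Lemma ltn_card_downclosed (p : pred nat) c : downclosed p ->
  (c < #|[pred i : 'I_N | p i]|) = (c < N) && p c.
Proof.
move=> dp; apply/idP/andP => [cp|[cN pc]].
  have cN : c < N by rewrite -[X in _ < X]card_ord; apply: leq_trans cp (max_card _).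
  split=> //; apply: contraLR cp => npc; rewrite -leqNgt.
  have inj : injective (widen_ord (ltnW cN)) by move=> a b [] /val_inj.
  rewrite -[X in _ <= X]card_ord -(fintype.card_image inj).
  apply/fintype.subset_leq_card/fintype.subsetP => i pi.
  have ic : i < c by rewrite ltnNge; apply: contra npc => ci; apply: dp ci pi.
  by apply/fintype.imageP; exists (Ordinal ic) => //; exact: val_inj.
have inj : injective (widen_ord cN) by move=> a b [] /val_inj.
rewrite -[X in X <= _]card_ord -(fintype.card_image inj).
apply/fintype.subset_leq_card/fintype.subsetP => _ /fintype.imageP[i _ ->].
by apply: dp pc; rewrite -ltnS; exact: (ltn_ord i).
Qed.

(** Initial segments are nested, so the union is the longer one; the maximum in the recursion for
    shapes comes from here. *)
Lemma card_downclosedU (p q : pred nat) : downclosed p -> downclosed q ->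
  #|[pred i : 'I_N | p i || q i]| =
  maxn #|[pred i : 'I_N | p i]| #|[pred i : 'I_N | q i]|.
Proof.
move=> dp dq; apply: eq_from_ltn => c; rewrite leq_max !ltn_card_downclosed //.
rewrite (@ltn_card_downclosed (fun i => p i || q i)) ?andb_orr //.
by move=> a b ab /orP[/(dp _ _ ab)->|/(dq _ _ ab)->] //; rewrite orbT.
Qed.

End DownClosed.

(** * Reverse plane partitions and their weight matrices *)

Section RppWeight.
Variables (l : nat) (lam : l.-tuple nat) (n : nat).
Implicit Types (T : filling lam n).

(* Outside the shape the entry is n, larger than every entry of T; this makes a
   reverse plane partition weakly increasing on the whole quadrant. *)
Definition entry T (r c : nat) : nat :=
  if [pick b | (brow b == r :> nat) && (bcol b == c)] is Some b then T b else n.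

Lemma box_at r c : c < nth 0 lam r ->
  exists b : box lam, brow b = r :> nat /\ bcol b = c.
Proof.
have [rl|lr] := ltnP r l; last by rewrite nth_default ?size_tuple.
rewrite -(tnth_nth 0 lam (Ordinal rl)) => cr.
by exists (Tagged (fun r => 'I_(tnth lam r)) (Ordinal cr)).
Qed.

Lemma bcol_lt (b : box lam) : bcol b < nth 0 lam (brow b).
Proof. by rewrite -tnth_nth; exact: ltn_ord. Qed.

Lemma box_inj (b b' : box lam) :
  brow b = brow b' :> nat -> bcol b = bcol b' -> b = b'.
Proof.
case: b b' => [r c] [r' c']; rewrite /brow /bcol /= => /val_inj e.
by case: r' / e c' => c' /val_inj ->.
Qed.

Lemma entry_box T b : entry T (brow b) (bcol b) = T b.
Proof.
rewrite /entry; case: pickP => [b' /andP[/eqP er /eqP ec]|/(_ b)].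
  by rewrite (box_inj er ec).
by rewrite !eqxx.
Qed.

Lemma ltn_entry T r c : (entry T r c < n) = (c < nth 0 lam r).
Proof.
apply/idP/idP => [|/box_at[b [<- <-]]]; last by rewrite entry_box.
rewrite /entry; case: pickP => [b /andP[/eqP<- /eqP<-]|_]; last by rewrite ltnn.
by rewrite bcol_lt.
Qed.

Lemma entry_leq T r c : entry T r c <= n.
Proof. by rewrite /entry; case: pickP => // b _; exact/ltnW. Qed.

Lemma entry_inj T T' : entry T =2 entry T' -> T = T'.
Proof. by move=> e; apply/ffunP => b; apply: val_inj; rewrite /= -!entry_box e. Qed.

Hypothesis lam_partition : sorted geq lam.

Lemma partition_nth r r' : r <= r' -> nth 0 lam r' <= nth 0 lam r.
Proof.
move=> rr'; have [r'l|lr'] := ltnP r' l; last by rewrite nth_default ?size_tuple.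
have geq_tr : transitive geq by move=> a b c /= ab bc; exact: leq_trans bc ab.
apply: (sorted_leq_nth geq_tr leqnn 0 lam_partition) => //; rewrite inE size_tuple //.
exact: leq_ltn_trans r'l.
Qed.

Definition entry_mono T := forall r r' c c',
  r <= r' -> c <= c' -> entry T r c <= entry T r' c'.

Lemma is_rppP T : reflect (entry_mono T) (is_rpp T).
Proof.
apply: (iffP idP) => [/forallP rT r r' c c' rr' cc'|mT]; last first.
  apply/forallP => b; apply/forallP => b'; apply/implyP => h.
  rewrite -!entry_box; apply: mT.
    by case/orP: h => /andP[/eqP e h] //; rewrite e.
  by case/orP: h => /andP[/eqP e h] //; rewrite e.
have [c'r'|c'r'] := ltnP c' (nth 0 lam r'); last first.
  apply: leq_trans (entry_leq _ _ _) _; rewrite leqNgt ltn_entry.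
  by rewrite -leqNgt.
have c'r := leq_trans c'r' (partition_nth rr').
have [b [br bc]] := box_at (leq_ltn_trans cc' c'r).
have [b1 [br1 bc1]] := box_at c'r.
have [b' [br' bc']] := box_at c'r'.
have eE (a : box lam) p q : brow a = p :> nat -> bcol a = q -> entry T p q = T a.
  by move=> <- <-; exact: entry_box.
rewrite (eE b) // (eE b') //; apply: (@leq_trans (T b1)).
  have /forallP/(_ b1)/implyP := rT b; apply.
  by rewrite -(inj_eq val_inj) /= br br1 bc bc1 eqxx cc'.
have /forallP/(_ b')/implyP := rT b1; apply.
by rewrite bc1 bc' eqxx br1 br' rr' orbT.
Qed.

(* Row r (from the top), column j of the weight matrix attached to T: the number
   of columns whose lowest entry j lies in row r. *)
Definition rpp_weight T (r j : nat) : nat :=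
  #|[pred c : 'I_(nth 0 lam 0) | (entry T r c == j) && (j < entry T r.+1 c)]|.

(** Entries are 0-based, so the strict inequality means a 1-based entry at most [j]: this is
    S(r,j). *)
Definition rpp_shape T (r j : nat) : nat :=
  #|[pred c : 'I_(nth 0 lam 0) | entry T r c < j]|.

(** Rows increase, so the counted columns form an initial segment; [j <= n] keeps the default entry
    [n] out of the count. *)
Lemma ltn_rpp_shape T r j c : entry_mono T -> j <= n ->
  (c < rpp_shape T r j) = (entry T r c < j).
Proof.
move=> mT jn; rewrite /rpp_shape.
rewrite (@ltn_card_downclosed _ (fun c => entry T r c < j)); last first.
  by move=> a b ab; apply: leq_ltn_trans; exact: mT.
apply: andb_idl => h; apply: (@leq_trans (nth 0 lam r)); last exact: partition_nth.
by rewrite -(ltn_entry T) (leq_trans h).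
Qed.

Lemma rpp_shapeS T r j : entry_mono T ->
  rpp_shape T r j.+1 =
  maxn (rpp_shape T r.+1 j.+1) (rpp_shape T r j) + rpp_weight T r j.
Proof.
move=> mT; rewrite /rpp_shape -(card_downclosedU _ (p := fun c => entry T r.+1 c < j.+1)
  (q := fun c => entry T r c < j)); first last.
- by move=> a b ab; apply: leq_ltn_trans; exact: mT.
- by move=> a b ab; apply: leq_ltn_trans; exact: mT.
rewrite /rpp_weight -!sum1_card
  (bigID (fun c : 'I__ => (entry T r.+1 c < j.+1) || (entry T r c < j))) /=.
congr (_ + _); apply: eq_bigl => c; rewrite !inE;
  have := mT r r.+1 c c (leqnSn _) (leqnn _); lia.
Qed.

Lemma rpp_shape0 T r : rpp_shape T r 0 = 0.
Proof. by apply: fintype.eq_card0 => c; rewrite !inE ltn0. Qed.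

Lemma rpp_shape_out T j : j <= n -> rpp_shape T l j = 0.
Proof.
move=> jn; apply: fintype.eq_card0 => c; rewrite !inE; apply/negbTE; rewrite -leqNgt.
by rewrite (leq_trans jn) // leqNgt ltn_entry [nth 0 lam l]nth_default ?size_tuple.
Qed.

Lemma rpp_shape_n T r : rpp_shape T r n = nth 0 lam r.
Proof.
rewrite /rpp_shape (eq_card (B := [pred c : 'I__ | c < nth 0 lam r])); last first.
  by move=> c; rewrite !inE ltn_entry.
rewrite -sum1_card -(big_ord_widen _ (fun=> 1)) ?sum1_card ?card_ord //.
exact: partition_nth.
Qed.

Lemma last_passage_rpp (w : 'I_l -> 'I_n -> nat) T : entry_mono T ->
  (forall i j, w i j = rpp_weight T (rev_ord i) j) ->
  forall r j, r <= l -> j <= n -> last_passage w (l - r) j = rpp_shape T r j.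
Proof.
move=> mT wT r j rl jn.
pose F m k := if k <= n then rpp_shape T (l - m) k else 0.
(* The value at [m = 0] is set to 0 by hand: for [k > n], [rpp_shape T l k] would count the default
   entries [n]. *)
rewrite (@last_passage_unique _ _ w (fun m k => if m is 0 then 0 else
   rpp_shape T (l - m) k)) ?leq_subr //.
- case e: (l - r) => [|m]; last by rewrite -e subKn.
  have -> : r = l by lia.
  by rewrite rpp_shape_out.
- by case=> // m; rewrite rpp_shape0.
move=> i k; rewrite rpp_shapeS // wT /=; congr (maxn _ _ + _).
have := ltn_ord i; case: (val i) => [|m] h.
  by rewrite subn1 prednK // rpp_shape_out.
by congr rpp_shape; lia.
Qed.

(** The weights determine the last passage times, hence the shapes, and an entry is the threshold at
    which its box joins them. *)
Lemma rpp_weight_inj T T' : entry_mono T -> entry_mono T' ->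
  (forall (r : 'I_l) (j : 'I_n), rpp_weight T r j = rpp_weight T' r j) -> T = T'.
Proof.
move=> mT mT' eT; apply: entry_inj => r c.
pose w (i : 'I_l) (j : 'I_n) := rpp_weight T (rev_ord i) j.
have hT := @last_passage_rpp w _ mT (fun i j => erefl).
have hT' := @last_passage_rpp w _ mT' (fun i j => eT (rev_ord i) j).
have [rl|lr] := leqP r l; last first.
  suff out T1 : entry T1 r c = n by rewrite !out.
  apply/eqP; rewrite eqn_leq entry_leq leqNgt ltn_entry.
  by rewrite nth_default // size_tuple ltnW.
have e j : j <= n -> (entry T r c < j) = (entry T' r c < j).
  by move=> jn; rewrite -!ltn_rpp_shape // -hT // hT'.
have eh := e _ (entry_leq T r c); have eh' := e _ (entry_leq T' r c).
by move: eh eh'; rewrite !ltnn; lia.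
Qed.

(** From left to right, the last passage times to column [j] of the matrix are the parts of a
    partition that grows with [j] up to [lam]; [T] records when each box is added. *)
Lemma last_passage_vectorP (w : 'I_l -> 'I_n -> nat) :
  last_passage_vector w = lam <->
  exists2 T : filling lam n, is_rpp T &
    forall i j, w i j = rpp_weight T (rev_ord i) j.
Proof.
split=> [Gw|[T /is_rppP mT wT]]; last first.
  apply: eq_from_tnth => i; rewrite tnth_mktuple (last_passage_rpp mT wT) //.
    by rewrite rpp_shape_n -tnth_nth.
  exact: ltnW.
have Gn r : last_passage w (l - r) n = nth 0 lam r.
  have [rl|lr] := ltnP r l.
    by rewrite -Gw (_ : r = Ordinal rl) // -tnth_nth tnth_mktuple.
  by rewrite nth_default ?size_tuple // (eqP lr) last_passage0n.
(* Monotonicity in each index: [Gcol] makes [h] a threshold, [Grow] makes [T] increase down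
   columns. *)
have Gcol j k m : m <= l -> j <= k -> k <= n ->
    last_passage w m j <= last_passage w m k.
  move=> ml jk kn; rewrite -(subnKC jk) in kn *; elim: (k - j) kn => [|d IH] kn.
    by rewrite addn0.
  rewrite addnS in kn *; apply: leq_trans (IH (ltnW kn)) _.
  case: m ml {IH} => [|m] ml; first by rewrite !last_passage0n.
  rewrite (last_passageSS w (Ordinal ml) (Ordinal kn)) /=.
  by apply: leq_trans (leq_addr _ _); exact: leq_maxr.
have Grow k m m' : k <= n -> m <= m' -> m' <= l ->
    last_passage w m k <= last_passage w m' k.
  move=> kn mm' m'l; rewrite -(subnKC mm') in m'l *; elim: (m' - m) m'l => [|d IH] ml.
    by rewrite addn0.
  rewrite addnS in ml *; apply: leq_trans (IH (ltnW ml)) _.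
  case: k kn {IH} => [|k] kn; first by rewrite !last_passagen0.
  rewrite (last_passageSS w (Ordinal ml) (Ordinal kn)) /=.
  by apply: leq_trans (leq_addr _ _); exact: leq_maxl.
pose G r j := last_passage w (l - r) j.
(* Since [G r] is nondecreasing, [h r c] is the least j with c < G r j.+1, and n
   if there is none. *)
pose h r c := #|[pred j : 'I_n | G r j.+1 <= c]|.
have ltn_h r c j : (j < h r c) = (j < n) && (G r j.+1 <= c).
  pose p j := (j < n) && (G r j.+1 <= c).
  rewrite /h (eq_card (B := [pred j : 'I_n | p j])); last first.
    by move=> k; rewrite !inE /p ltn_ord.
  rewrite ltn_card_downclosed; first by rewrite andbA andbb.
  move=> a b ab /andP[bn Gb]; rewrite /p (leq_ltn_trans ab bn) /=.
  by apply: leq_trans Gb; apply: Gcol => //; exact: leq_subr.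
have h_full r c : nth 0 lam r <= c -> h r c = n.
  rewrite -Gn => Gc; rewrite /h -[RHS]card_ord; apply: eq_card => j; rewrite !inE.
  by apply: leq_trans Gc; apply: Gcol => //; exact: leq_subr.
have h_lt (b : box lam) : h (brow b) (bcol b) < n.
  rewrite ltnNge; apply/negP => nh; have := bcol_lt b; rewrite ltnNge => /negP; apply.
  rewrite -Gn; have [n0|n_gt0] := posnP n; last first.
    by have := ltn_h (brow b) (bcol b) n.-1; rewrite prednK // nh => /esym/andP[].
  have G0 m k : k = 0 -> last_passage w m k = 0 by move=> ->; exact: last_passagen0.
  by rewrite G0.
pose T : filling lam n := [ffun b => Ordinal (h_lt b)].
have Th r c : entry T r c = h r c.
  have [/box_at[b [<- <-]]|lc] := ltnP c (nth 0 lam r).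
    by rewrite entry_box ffunE.
  by apply/eqP; rewrite h_full // eqn_leq entry_leq leqNgt ltn_entry -leqNgt.
have mT : entry_mono T.
  move=> r r' c c' rr' cc'; rewrite !Th.
  apply/fintype.subset_leq_card/fintype.subsetP => j.
  rewrite !inE => Gc; apply: leq_trans cc'; apply: leq_trans Gc.
  by apply: Grow => //; [exact: leq_sub2l | exact: leq_subr].
exists T => [|i j]; first exact/is_rppP.
have GT r k : k <= n -> rpp_shape T r k = G r k.
  move=> kn; apply: eq_from_ltn => c; rewrite ltn_rpp_shape // Th.
  case: k kn => [|k] kn; first by rewrite /G last_passagen0 !ltn0.
  by rewrite ltnS leqNgt ltn_h kn /= -ltnNge.
(* The two recursions now share their left side and their maximum; cancelling leaves the weights. *)
have := rpp_shapeS (rev_ord i) j mT; rewrite !GT ?(ltnW (ltn_ord j)) // /G /=.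
have -> : l - (l - i.+1) = i.+1 by rewrite subKn.
have -> : l - (l - i.+1).+1 = i by have := ltn_ord i; lia.
by rewrite last_passageSS => /addnI.
Qed.

End RppWeight.

(** * Row and column sums of the weight matrix *)

(* A nondecreasing f that takes the value j leaves it exactly once. *)
Lemma sum_last_visit (f : nat -> nat) j k : {homo f : a b / a <= b} ->
  \sum_(r < k) ((f r == j) && (j < f r.+1)) =
  (j < f k) && [exists r : 'I_k, f r == j] :> nat.
Proof.
move=> mf; elim: k => [|k IH].
  by rewrite big_ord0; case: existsP => [[[]]|_] //; rewrite andbF.
rewrite big_ord_recr IH /=; have fS := mf k k.+1 (leqnSn k).
have -> : [exists r : 'I_k.+1, f r == j] = [exists r : 'I_k, f r == j] || (f k == j).
  apply/existsP/orP => [[r fr]|[/existsP[r fr]|fk]]; last by exists ord_max.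
    have := ltn_ord r; rewrite ltnS leq_eqVlt => /orP[/eqP <-|rk]; first by right.
    by left; apply/existsP; exists (Ordinal rk).
  by exists (widen_ord (leqnSn k) r).
have ex_le : [exists r : 'I_k, f r == j] -> j <= f k.
  by move=> /existsP[r /eqP <-]; apply: mf; exact/ltnW.
by case: [exists r, _] ex_le => [/(_ isT)|_] /=; lia.
Qed.

Lemma card_predE (I : finType) (P : pred I) : #|[pred i | P i]| = \sum_i P i.
Proof.
by rewrite -sum1_card big_mkcond; apply: eq_bigr => i _; rewrite inE; case: (P i).
Qed.

Section RppWeightSums.
Variables (l : nat) (lam : l.-tuple nat) (n : nat) (T : filling lam n).
Hypothesis lam_partition : sorted geq lam.
Hypothesis mT : entry_mono T.

Lemma bcol_lt0 (b : box lam) : bcol b < nth 0 lam 0.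
Proof. by apply: leq_trans (bcol_lt b) _; exact: partition_nth. Qed.

(** A column containing [j] has exactly one lowest occurrence of [j], so exactly one row counts
    it. *)
Lemma rpp_aE j : rpp_a T j = \sum_(r < l) rpp_weight T r j.
Proof.
rewrite /rpp_a card_predE (eq_bigr _ (fun r _ => card_predE _)) exchange_big /=.
apply: eq_bigr => c _.
rewrite (sum_last_visit (f := fun r => entry T r c)); last first.
  by move=> a b ab; exact: mT.
have -> : j < entry T l c.
  have -> : entry T l c = n; last exact: ltn_ord.
  apply/eqP; rewrite eqn_leq entry_leq leqNgt ltn_entry.
  by rewrite [nth 0 lam l]nth_default ?size_tuple.
congr nat_of_bool; apply/existsP/existsP => -[b /=].
  by case/andP=> /eqP <- /eqP <-; exists (brow b); rewrite entry_box.
move=> /eqP e; have /box_at[b' [br bc]] : c < nth 0 lam b by rewrite -(ltn_entry T) e.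
by exists b'; rewrite bc eqxx -(inj_eq val_inj) /= -entry_box br bc e.
Qed.

(** In a fixed row, boxes are determined by their columns. The bound by [n] discards columns where
    both entries are the default. *)
Lemma rpp_bE r :
  rpp_b T r = \sum_(c < nth 0 lam 0)
    ((entry T r.+1 c == entry T r c) && (entry T r c < n)).
Proof.
rewrite -card_predE /rpp_b; set A := [pred b | _].
pose f (b : box lam) := Ordinal (bcol_lt0 b).
have f_inj : {in A &, injective f}.
  move=> b b' /andP[/eqP br _] /andP[/eqP br' _] [bc].
  by apply: box_inj => //; rewrite br br'.
rewrite -(card_in_image f_inj); apply: eq_card => c; rewrite inE.
apply/fintype.imageP/andP => [[b /andP[/eqP <- /existsP[b']] + ->]|].
  move=> /and3P[/eqP br /eqP bc /eqP bT].
  by rewrite -br /= entry_box -{1}bc entry_box bT.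
move=> [/eqP e]; have [en|] := boolP (entry T r c < n); last by [].
have := en; rewrite ltn_entry => /box_at[b [br bc]] _.
have := en; rewrite -e ltn_entry => /box_at[b' [br' bc']].
exists b; last exact: val_inj.
apply/andP; split; first exact/eqP/val_inj.
apply/existsP; exists b'.
by rewrite br' br bc' bc !eqxx -(inj_eq val_inj) /= -!entry_box br br' bc bc' e.
Qed.

(** A box of row [r] either has its entry repeated below, or is the lowest occurrence of it and
    counts in one weight. *)
Lemma sum_rpp_weight (r : 'I_l) :
  \sum_(j < n) rpp_weight T r j + rpp_b T r = tnth lam r.
Proof.
rewrite rpp_bE (eq_bigr _ (fun j _ => card_predE _)) exchange_big /= -big_split /=.
rewrite (tnth_nth 0) -(rpp_shape_n lam_partition T r) /rpp_shape card_predE.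
apply: eq_bigr => c _; have le_e := mT (leqnSn r) (leqnn c).
have -> : \sum_(j < n) ((entry T r c == j) && (j < entry T r.+1 c)) =
    (entry T r c < entry T r.+1 c) :> nat.
  have [en|ne] := ltnP (entry T r c) n.
    rewrite (bigD1 (Ordinal en)) //= eqxx big1 ?addn0 // => j.
    by rewrite -(inj_eq val_inj) eq_sym => /negbTE /= ->.
  rewrite big1 => [|j _].
    by have := entry_leq T r.+1 c; lia.
  by have := ltn_ord j; lia.
by have := entry_leq T r.+1 c; lia.
Qed.

End RppWeightSums.

(** * Summing the probabilities of the weight matrices *)

Local Open Scope classical_set_scope.
Local Open Scope ring_scope.

Lemma prod_rpp_weight (R : fieldType) (l n : nat) (lam : l.-tuple nat)
    (T : filling lam n) (t : 'I_l -> R) (x : 'I_n -> R) :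
  (forall i, t i != 0) -> sorted geq lam -> is_rpp T ->
  \prod_(i < l) \prod_(j < n) (t i * x j) ^+ rpp_weight T i j =
  (\prod_(i < l) t i ^+ tnth lam i) *
  ((\prod_(i < l) (t i)^-1 ^+ rpp_b T i) * \prod_(j < n) x j ^+ rpp_a T j).
Proof.
move=> t_neq0 lam_partition /(is_rppP lam_partition) mT.
under eq_bigr do under eq_bigr do rewrite exprMn.
under eq_bigr do rewrite big_split /= prodrXr.
rewrite big_split /= mulrA; congr (_ * _); last first.
  rewrite exchange_big /=; apply: eq_bigr => j _.
  by rewrite prodrXr -(rpp_aE mT).
rewrite -big_split /=; apply: eq_bigr => i _.
by rewrite -(sum_rpp_weight lam_partition mT) exprD exprVn mulfK // expf_neq0.
Qed.

(* The row parameters are attached to the weights in the order t_l, ..., t_1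
   (from the bottom row up): G(l,n), listed first in the vector, is matched with
   t_1 by t^lam.  With the order t_1, ..., t_l the identity fails already for
   l = 2, n = 1, lam = (1,0). *)
Theorem theorem4p8 (R : realType) (d : measure_display) (T : measurableType d)
    (P : probability T R) (l n : nat) (l_gt0 : (0 < l)%N) (n_gt0 : (0 < n)%N)
    (t : 'I_l -> R) (x : 'I_n -> R)
    (t01 : forall i, 0 < t i < 1) (x01 : forall j, 0 < x j < 1)
    (w : 'I_l -> 'I_n -> {RV P >-> nat})
    (w_indep : mutually_independent (fun c : 'I_l * 'I_n => w c.1 c.2))
    (w_geom : forall (i : 'I_l) (j : 'I_n) (k : nat),
      P [set o | w i j o = k] =
      ((1 - t (rev_ord i) * x j) * (t (rev_ord i) * x j) ^+ k)%:E)
    (lam : l.-tuple nat) (lam_partition : sorted geq lam) :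
  P [set o | last_passage_vector (fun i j => w i j o) = lam] =
  ((\prod_(i < l) \prod_(j < n) (1 - t i * x j)) *
   (\prod_(i < l) t i ^+ tnth lam i) *
   dual_grothendieck lam x (fun i => (t i)^-1))%:E.
Proof.
(* The event that the weights are those of [S], as an intersection to which independence applies.
   [rev_ord] matches diagram rows, from the top, with matrix rows, from the bottom. *)
pose E (S : filling lam n) :=
  \bigcap_(c in [set` [set: 'I_l * 'I_n]%SET])
    (w c.1 c.2 @^-1` [set rpp_weight S (rev_ord c.1) c.2]).
have EE S o : E S o <-> forall i j, w i j o = rpp_weight S (rev_ord i) j.
  split=> [h i j|h c _]; last exact: h.
  by apply: (h (i, j)); rewrite /= finset.in_setT.
have -> : [set o | last_passage_vector (fun i j => w i j o) = lam] =
    \bigcup_(S in [set` [pred S : filling lam n | is_rpp S]]) E S.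
  apply/seteqP; split => o /=.
    by case/last_passage_vectorP => // S rS wS; exists S => //; exact/EE.
  by case=> S rS /EE wS; apply/last_passage_vectorP => //; exists S.
have PE S : is_rpp S -> P (E S) = ((\prod_(i < l) \prod_(j < n) (1 - t i * x j)) *
    ((\prod_(i < l) t i ^+ tnth lam i) *
  ((\prod_(i < l) (t i)^-1 ^+ rpp_b S i) * \prod_(j < n) x j ^+ rpp_a S j)))%:E.
  move=> rS; rewrite w_indep //.
  rewrite (eq_bigr (fun c => ((1 - t (rev_ord c.1) * x c.2) *
    (t (rev_ord c.1) * x c.2) ^+ rpp_weight S (rev_ord c.1) c.2)%:E)); last first.
    by move=> c _; rewrite -w_geom.
  rewrite prodEFin -(@prod_rpp_weight _ _ _ _ S t x) //; last first.
    by move=> i; have /andP[/lt0r_neq0] := t01 i.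
  congr EFin; under eq_bigl do rewrite finset.in_setT.
  (* The product over rows is reversed to match the parameters [t (rev_ord i)]. *)
  rewrite -big_split /= (reindex_inj rev_ord_inj) /=.
  under [RHS]eq_bigr do rewrite -big_split /=.
  by rewrite pair_bigA.
rewrite measure_fin_bigcup //=.
- rewrite -(@bigfs _ _ _ _ (index_enum (filling lam n))) //= ?index_enum_uniq //.
    rewrite (eq_bigr _ PE) sumEFin -!mulr_sumr mulrA //.
  by move=> i _; rewrite mem_index_enum.
(* Disjointness: a common outcome gives [S] and [S'] the same weights. *)
- move=> S S' rS rS' [z [/EE wS /EE wS']].
  apply: (rpp_weight_inj lam_partition); [exact/is_rppP|exact/is_rppP|].
  by move=> r j; rewrite -[r]rev_ordK -wS -wS'.
- move=> S _; apply: fin_bigcap_measurable => // c _.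
  exact: measurable_funPTI.
Qed.
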